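(* Let $p$ be a prime and $f\geqslant1$ be such that $q=p^f\equiv-1\pmod 4$. Then there is a (finite) primitive permutation group $G$ such that $G/D(G)\cong D_{q+1}$.
   Context: For a finite permutation group $G$, $D(G)$ denotes the subgroup of $G$ generated by the derangements in $G$, i.e. the elements with no fixed points. In contrast, $D_{m}$ with an integer subscript $m$ denotes the dihedral group of order $m$; so $D_{q+1}$ is the dihedral group of order $q+1$ (the Klein four-group when $q=3$). *)

(* Defs.v *)
From mathcomp Require Import all_boot all_fingroup all_solvable.

Set Implicit Arguments.
Unset Strict Implicit.
Unset Printing Implicit Defensive.

Import GroupScope.

Section Derangements.

Variable T : finType.

Definition derangements (G : {set {perm T}}) : {set {perm T}} :=
  [set g in G | [forall x : T, g x != x]].

Definition derangement_subgroup (G : {set {perm T}}) : {set {perm T}} :=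
  <<derangements G>>.

Canonical derangement_group (G : {set {perm T}}) : {group {perm T}} :=
  Eval hnf in [group of derangement_subgroup G].

(* In MathComp the quotient [G / H] is [N_G(H) H / H] for arbitrary [H]; by this
   lemma [G / derangement_subgroup G] is the ordinary quotient group. *)
Lemma derangement_subgroup_normal (G : {group {perm T}}) :
  derangement_subgroup G <| G.
Proof.
rewrite /normal gen_subG; apply/andP; split.
  by apply/subsetP => g; rewrite inE => /andP[].
apply/norms_gen/subsetP => h Gh; rewrite inE.
apply/subsetP => _ /imsetP[g + ->]; rewrite !inE => /andP[Gg /forallP dg].
rewrite groupJ //=; apply/forallP => x.
by rewrite -{1 2}[x](permKV h) permJ (inj_eq perm_inj) dg.
Qed.

End Derangements.

(* Main.v *)
Require Import Defs.
From mathcomp Require Import all_boot all_fingroup all_solvable all_algebra all_field.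

(* Let P be a 2-transitive group with a transitive normal subgroup N such that
   N contains a derangement and every element of P outside N fixes exactly one
   point, and let p be a prime not dividing |P : N|. In the wreath product of P
   with C_p acting on p-tuples, let G consist of the elements whose coordinates
   are all congruent modulo N. If s in G has coordinates outside N, then so does
   s^p, which has trivial shift; hence s^p has a unique fixed tuple, which s must
   fix too. So the derangements of G lie in the wreath product of N with C_p,
   and they generate it; thus G / D(G) is P / N. If moreover point stabilisers
   in N fix no second point, G is primitive.
   For P take the affine group of the Dickson nearfield of order q^2: the maps
   x -> a x + w (a a nonzero square) and x -> a x^q + w (a a nonsquare) of
   F_{q^2}, with N given by the a in F_q^*. If a is a
   nonsquare, the square of x -> a x^q is multiplication by a^(q+1), an element
   of F_q^*; the resulting involutions make P / N dihedral of order q + 1. *)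

Set Implicit Arguments.
Unset Strict Implicit.
Unset Printing Implicit Defensive.

(** * Wreath product permutations of tuples and the subgroup with congruent coordinates *)

Section ProductAction.
Import GroupScope.

Variables (Omega : finType) (p : nat).
Local Notation vect := {ffun 'F_p -> Omega}.
Implicit Types (x y : 'F_p -> {perm Omega}) (i j k : 'F_p) (v : vect).

Definition wr_fun x j v : vect := [ffun i => x i (v (i - j)%R)].

Lemma wr_fun_inj x j : injective (wr_fun x j).
Proof.
move=> v w /ffunP eq_vw; apply/ffunP=> i; have := eq_vw (i + j)%R.
by rewrite !ffunE GRing.addrK => /perm_inj.
Qed.

Definition wr x j : {perm vect} := perm (@wr_fun_inj x j).

Lemma wrE x j v i : wr x j v i = x i (v (i - j)%R).
Proof. by rewrite permE ffunE. Qed.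

Lemma eq_wr x y j : x =1 y -> wr x j = wr y j.
Proof. by move=> eq_xy; apply/permP=> v; apply/ffunP=> i; rewrite !wrE eq_xy. Qed.

Lemma wrM x y j k :
  wr x j * wr y k = wr (fun i => x (i - k)%R * y i) (j + k)%R.
Proof.
apply/permP=> v; apply/ffunP=> i; rewrite permM !wrE permM.
by rewrite GRing.opprD [(- j + _)%R]GRing.addrC GRing.addrA.
Qed.

Lemma wr1 : wr (fun=> 1) 0%R = 1.
Proof. by apply/permP=> v; apply/ffunP=> i; rewrite wrE !perm1 GRing.subr0. Qed.

Variables P N : {group {perm Omega}}.
Hypothesis nsNP : N <| P.

Definition congruent x :=
  [forall i, (x i \in P) && (coset N (x i) == coset N (x 0%R))].

Lemma congruentP x :
  reflect (forall i, x i \in P /\ coset N (x i) = coset N (x 0%R)) (congruent x).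
Proof.
apply: (iffP forallP) => xP i; first by case/andP: (xP i) => ? /eqP.
by case: (xP i) => -> ->; rewrite eqxx.
Qed.

(** The coordinates are finfuns here so that the set is an image of a finite type; [mem_twisted] and
    [twistedP] return to plain functions. *)
Definition twisted_wreath : {set {perm vect}} :=
  [set wr u.1 u.2 | u : {ffun 'F_p -> {perm Omega}} * 'F_p & congruent u.1].

Lemma mem_twisted x j : congruent x -> wr x j \in twisted_wreath.
Proof.
move=> xP; have eq_x: x =1 finfun x by move=> i; rewrite ffunE.
apply/imsetP; exists (finfun x, j); last exact: eq_wr.
by rewrite inE /=; apply/congruentP=> i; rewrite !ffunE; apply/congruentP.
Qed.

Lemma twistedP s :
  s \in twisted_wreath -> exists x j, congruent x /\ s = wr x j.
Proof. by case/imsetP=> -[x j]; rewrite inE /= => xP ->; exists x, j. Qed.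

Let nNP : {subset P <= 'N(N)}.
Proof. exact/subsetP/normal_norm. Qed.

Let cosetM : {in P &, {morph coset N : g h / g * h}}.
Proof. by move=> g h Pg Ph; rewrite morphM ?nNP. Qed.

Lemma congruent_in x : (forall i, x i \in N) -> congruent x.
Proof.
move=> Nx; apply/congruentP=> i; rewrite (subsetP (normal_sub nsNP)) //.
by rewrite !coset_id.
Qed.

Lemma congruent_const g : g \in P -> congruent (fun=> g).
Proof. by move=> Pg; apply/congruentP. Qed.

Lemma congruentM x y k : congruent x -> congruent y ->
  congruent (fun i => x (i - k)%R * y i).
Proof.
move=> /congruentP xP /congruentP yP; apply/congruentP=> i.
have [[Px1 ex1] [Px2 ex2]] := (xP (i - k)%R, xP (0 - k)%R).
have [[Py1 ey1] [Py2 ey2]] := (yP i, yP 0%R).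
by rewrite groupM // !cosetM // ex1 ex2 ey1.
Qed.

Lemma twisted_group_set : group_set twisted_wreath.
Proof.
apply/group_setP; split; first by rewrite -wr1 mem_twisted ?congruent_const.
move=> _ _ /twistedP[x [j [xP ->]]] /twistedP[y [k [yP ->]]].
by rewrite wrM mem_twisted ?congruentM.
Qed.
Canonical twisted_group := Group twisted_group_set.

(** The shift permutes coordinates that all have the same class modulo [N], so taking this common
    class is multiplicative whatever the shifts are. *)
Lemma wr_powers x j n : congruent x ->
  exists y, [/\ wr x j ^+ n = wr y (j *+ n)%R, congruent y &
    forall i, coset N (y i) = coset N (x 0%R) ^+ n].
Proof.
move=> xP; elim: n => [|n [y [def_xn yP ey]]].
  exists (fun=> 1); rewrite GRing.mulr0n wr1; split=> //.
    exact: congruent_const.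
  by move=> i; rewrite morph1.
exists (fun i => x (i - j *+ n)%R * y i); split.
- by rewrite expgS def_xn wrM GRing.mulrS.
- exact: congruentM.
move=> i; have [Px ex] := congruentP _ xP (i - j *+ n)%R.
have [Py _] := congruentP _ yP i.
by rewrite cosetM // ex ey expgS.
Qed.

(** * The subgroup generated by the derangements *)

Hypothesis p_pr : prime p.
Hypothesis coNP : coprime p #|P / N|.
Hypothesis N_trans : forall a b, exists2 g, g \in N & g a = b.
Hypothesis P_trans2 : forall a b c, b != a -> c != a ->
  exists g, [/\ g \in P, g a = a & g b = c].
Hypothesis N_stab : forall a b, b != a -> exists g, [/\ g \in N, g a = a & g b != b].
Hypothesis fix1 : forall g, g \in P :\: N ->
  exists a, forall b, (g b == b) = (b == a).
Hypothesis N_der : exists2 g, g \in N & forall a, g a != a.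

Local Notation G := twisted_group.
Local Notation D := (derangement_group G).

Lemma wr_not_derangement x j : congruent x -> x 0%R \notin N ->
  exists v, wr x j v = v.
Proof.
move=> xP nNx; have [Px0 _] := congruentP _ xP 0%R.
have [y [def_xp yP ey]] := wr_powers j p xP.
have jp0: (j *+ p = 0)%R by rewrite -GRing.mulr_natr pchar_Fp_0 // GRing.mulr0.
have nNy i : y i \in P :\: N.
  have [Py _] := congruentP _ yP i; rewrite inE Py andbT.
  apply: contra nNx => Ny; have := ey i; rewrite coset_id // => /esym/eqP.
  rewrite -order_dvdn => oxp.
  (* If the [p]-th power fell into [N], the order of the class of [x 0] would divide both [p] and
     [#|P / N|]. *)
  have: #[coset N (x 0%R)] %| 1.
    by rewrite -(eqP coNP) dvdn_gcd oxp order_dvdG ?mem_quotient.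
  by rewrite dvdn1 order_eq1 => /eqP/coset_idr; apply; rewrite nNP.
have /fin_all_exists[v vP] i := fix1 (nNy i).
pose w : vect := finfun v.
have fixw u : (wr x j ^+ p) u = u -> u = w.
  move/ffunP=> fu; apply/ffunP=> i; move: (fu i).
  by rewrite def_xp jp0 wrE GRing.subr0 ffunE => /eqP; rewrite vP => /eqP.
have fix_w : (wr x j ^+ p) w = w.
  by apply/ffunP=> i; rewrite def_xp jp0 wrE GRing.subr0 ffunE; apply/eqP; rewrite vP.
(* An element commutes with its [p]-th power, so it maps the unique fixed vector of that power to a
   fixed vector, which is again [w]. *)
exists w; apply: fixw; rewrite -permM -expgS expgSr permM; congr (_ _).
exact: fix_w.
Qed.

(** The wreath product of [N] with the cyclic group of shifts, shown in [wr_derangements] to be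
    [D]. *)
Definition wr_kernel : {set {perm vect}} :=
  [set s | [exists u : {ffun 'F_p -> {perm Omega}} * 'F_p,
    [forall i, u.1 i \in N] && (s == wr u.1 u.2)]].

Lemma wr_kernelP s :
  reflect (exists x j, (forall i, x i \in N) /\ s = wr x j) (s \in wr_kernel).
Proof.
rewrite inE; apply: (iffP existsP) => [[[x j] /andP[/forallP Nx /eqP->]] |].
  by exists x, j.
case=> x [j [Nx ->]]; exists (finfun x, j) => /=; apply/andP; split.
  by apply/forallP=> i; rewrite ffunE.
by apply/eqP/eq_wr => i; rewrite ffunE.
Qed.

Lemma wr_kernel_group_set : group_set wr_kernel.
Proof.
apply/group_setP; split; first by apply/wr_kernelP; exists (fun=> 1), 0%R; rewrite wr1.
move=> _ _ /wr_kernelP[x [j [Nx ->]]] /wr_kernelP[y [k [Ny ->]]].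
by rewrite wrM; apply/wr_kernelP; do 2!eexists; split; last reflexivity;
   move=> i; rewrite groupM.
Qed.

Lemma der_sub_kernel : D \subset wr_kernel.
Proof.
rewrite -[wr_kernel]/(gval (Group wr_kernel_group_set)) gen_subG.
apply/subsetP=> _ /setIdP[/twistedP[x [j [xP ->]]] /forallP der_s].
apply/wr_kernelP; exists x, j; split=> // i.
have [Pxi exi] := congruentP _ xP i.
have [Nx0|] := boolP (x 0%R \in N).
  by move: exi; rewrite (coset_id Nx0) => /coset_idr; apply; apply: nNP.
by case/(wr_not_derangement j xP) => v /eqP; rewrite (negPf (der_s v)).
Qed.

(** Without a shift the action is coordinatewise, so a derangement in one coordinate already moves
    every vector. *)
Lemma kernel_der1 x i0 : (forall i, x i \in N) -> (forall a, x i0 a != a) ->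
  wr x 0%R \in D.
Proof.
move=> Nx der_x; apply: mem_gen; rewrite inE mem_twisted ?congruent_in //=.
apply/forallP=> v; apply/negP=> /eqP/ffunP/(_ i0)/eqP.
by rewrite wrE GRing.subr0 (negPf (der_x _)).
Qed.

Lemma kernel_der x : (forall i, x i \in N) -> wr x 0%R \in D.
Proof.
move=> Nx; have [d Nd der_d] := N_der.
have der_dV a : d^-1 a != a.
  by apply: contra (der_d a) => /eqP da; rewrite -{1}da permKV.
have n10 : (1 == 0 :> 'F_p)%R = false by [].
(* Each factor is a derangement: the first has [d] at coordinate 0, the second [d] at 1, the third
   [d^-1] at 1. At coordinates 0 and 1 the auxiliary entries cancel. *)
have -> : wr x 0%R
    = wr (fun i => if i == 0%R then d else x i) 0%R
    * wr (fun i => if i == 0%R then d^-1 * x 0%R else if i == 1%R then d else 1) 0%R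
    * wr (fun i => if i == 1%R then d^-1 else 1) 0%R.
  rewrite !wrM !GRing.addr0; apply: eq_wr => i; rewrite !GRing.subr0.
  have [->|_] := eqVneq i 0%R; first by rewrite eq_sym n10 mulg1 mulKVg.
  by case: eqP => _; rewrite ?mulgK ?mulg1.
rewrite !groupM //.
- by apply: (@kernel_der1 _ 0%R) => [i|a]; rewrite ?eqxx //; case: ifP.
- apply: (@kernel_der1 _ 1%R) => [i|a]; last by rewrite n10 eqxx.
  by do 2?case: ifP => _ //; rewrite groupM ?groupV.
apply: (@kernel_der1 _ 1%R) => [i|a]; last by rewrite eqxx.
by case: ifP; rewrite ?groupV.
Qed.

Lemma natF_neq0 n : 0 < n < p -> (n%:R != 0 :> 'F_p)%R.
Proof.
case/andP=> n_gt0 ltnp; rewrite -(GRing.dvdn_pcharf (pchar_Fp p_pr)).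
by rewrite gtnNdvd.
Qed.

(* A fixed vector would be constant along the orbit [0, j, 2j, ...] of the
   shift, contradicting the derangement met on returning to 0. *)
Lemma shift_der d j : d \in N -> (forall a, d a != a) -> j != 0%R ->
  wr (fun i => if i == 0%R then d else 1) j \in D.
Proof.
move=> Nd der_d nz_j; apply: mem_gen; rewrite inE mem_twisted /=; last first.
  by apply: congruent_in => i; case: ifP.
apply/forallP=> v; apply/negP=> /eqP/ffunP fix_v.
have step n : n < p -> v (j *+ n)%R = v 0%R.
  elim: n => [|n IHn] ltnp; first by rewrite GRing.mulr0n.
  rewrite -IHn 1?ltnW // -[LHS]fix_v wrE -GRing.mulr_natr.
  rewrite GRing.mulf_eq0 (negPf nz_j) (negPf (natF_neq0 _)) //= perm1.
  by rewrite GRing.mulr_natr GRing.mulrSr GRing.addrK.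
have /eqP := fix_v 0%R; rewrite wrE eqxx GRing.sub0r.
have <- : (j *+ p.-1 = - j)%R.
  apply/eqP; rewrite -GRing.addr_eq0 -GRing.mulrSr prednK ?prime_gt0 //.
  by rewrite -GRing.mulr_natr pchar_Fp_0 // GRing.mulr0.
by rewrite step ?prednK ?prime_gt0 // (negPf (der_d _)).
Qed.

Lemma wr_derangements : D = wr_kernel :> {set _}.
Proof.
apply/eqP; rewrite eqEsubset der_sub_kernel.
apply/subsetP=> _ /wr_kernelP[x [j [Nx ->]]].
have [->|nz_j] := eqVneq j 0%R; first exact: kernel_der.
have [d Nd der_d] := N_der.
pose d0 i := if i == 0%R then d else 1.
have Nd0 i : d0 i \in N by rewrite /d0; case: ifP.
(* Split off the derangement of [shift_der] with the same shift; the indices [i + j] undo the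
   displacement by [j] in [wrM]. *)
have -> : wr x j = wr (fun i => x (i + j)%R * (d0 (i + j)%R)^-1) 0%R * wr d0 j.
  rewrite wrM GRing.add0r; apply: eq_wr => i.
  by rewrite GRing.subrK mulgKV.
by rewrite groupM ?shift_der // kernel_der // => i; rewrite groupM ?groupV.
Qed.

(** * The quotient by the derangement subgroup *)

Definition wr_diag g : {perm vect} := wr (fun=> g) 0%R.

Lemma wr_diagM : {in P &, {morph wr_diag : g h / g * h}}.
Proof. by move=> g h _ _; rewrite /wr_diag wrM GRing.addr0. Qed.
Canonical wr_diag_morphism := Morphism wr_diagM.

(** The diagonal copy of [P] maps onto [G / D], because congruent coordinates differ from the
    constant tuple [x 0] by elements of [N]. It meets [D] exactly in the diagonal of [N]. *)
Lemma wr_quotient : (G / D)%g \isog (P / N)%g.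
Proof.
have nsDG : D <| G := derangement_subgroup_normal G.
have sDP : P \subset wr_diag @*^-1 'N(D).
  apply/subsetP=> g Pg; apply/morphpreP; split=> //.
  apply: (subsetP (normal_norm nsDG)).
  exact/mem_twisted/congruent_const.
pose f := [morphism of restrm sDP (coset D \o wr_diag)].
have kf : 'ker f = N.
  apply/setP=> g; rewrite ker_restrm ker_comp ker_coset.
  apply/setIP/idP=> [[Pg /morphpreP[_]]|Ng].
    rewrite /= wr_derangements => /wr_kernelP[x [j [Nx def_x]]].
    suffices -> : g = x 0%R by [].
    (* On a constant vector the unknown shift [j] has no effect. *)
    apply/permP=> a; move/permP/(_ [ffun=> a])/ffunP/(_ 0%R): def_x.
    by rewrite !wrE !ffunE.
  have Pg := subsetP (normal_sub nsNP) g Ng; split=> //; apply/morphpreP; split=> //.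
  by rewrite /= wr_derangements; apply/wr_kernelP; exists (fun=> g), 0%R.
have <- : f @* P = (G / D)%g.
  apply/eqP; rewrite eqEsubset; apply/andP; split.
    apply/subsetP=> _ /morphimP[g _ Pg ->]; rewrite /= mem_quotient //.
    exact/mem_twisted/congruent_const.
  apply/subsetP=> _ /morphimP[s nDs /twistedP[x [j [xP def_s]]] ->].
  have [Px0 _] := congruentP _ xP 0%R.
  suffices def_sD : coset D s = f (x 0%R).
    by change (coset D s \in f @* P); rewrite def_sD mem_morphim.
  have -> : s = wr (fun i => x i * (x 0%R)^-1) j * wr_diag (x 0%R).
    rewrite def_s wrM GRing.addr0; apply: eq_wr => i.
    by rewrite GRing.subr0 mulgKV.
  apply: coset_kerl; rewrite /= wr_derangements; apply/wr_kernelP.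
  do 2!eexists; split; last reflexivity.
  move=> i; have [Pxi exi] := congruentP _ xP i.
  apply: coset_idr; first by rewrite nNP ?groupM ?groupV.
  by rewrite cosetM ?groupV // exi -cosetM ?groupV // mulgV morph1.
by rewrite isog_sym; have := first_isog f; rewrite kf.
Qed.

(** * Transitivity and primitivity on tuples *)

Lemma wr_trans v w : exists x, (forall i, x i \in N) /\ wr x 0%R v = w.
Proof.
have /fin_all_exists[x xP] i : exists g, g \in N /\ g (v i) = w i.
  by have [g] := N_trans (v i) (w i); exists g.
exists x; split=> [i|]; first by case: (xP i).
by apply/ffunP=> i; rewrite wrE GRing.subr0; case: (xP i).
Qed.

Lemma wr_transitive (o : Omega) : [transitive G, on [set: vect] | 'P].
Proof.
apply/imsetP; exists [ffun=> o]; first by rewrite inE.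
apply/esym/setP=> w; rewrite inE; apply/imsetP.
have [x [Nx <-]] := wr_trans [ffun=> o] w.
by exists (wr x 0%R) => //; apply/mem_twisted/congruent_in.
Qed.

Section Maximality.

Variables (v : vect) (H : {group {perm vect}}).
Hypotheses (sCH : 'C_G[v | 'P] \subset H) (sHG : H \subset G).

Implicit Types u w : vect.

Definition reached w := exists2 h, h \in H & h v = w.

(** The lines of the Hamming graph on tuples. Once the orbit of [v] under [H] contains one line
    through one of its points, it is everything. *)
Definition line_reached w i :=
  forall u : vect, (forall k, k != i -> u k = w k) -> reached u.

Lemma reachedJ w h : h \in H -> reached w -> reached (h w).
Proof.
by move=> Hh [g Hg <-]; exists (g * h); rewrite ?groupM // permM.
Qed.

(** The stabilisers of points in the orbit of [v] under [H] are conjugate by elements of [H], and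
    that of [v] lies in [H]. *)
Lemma stab_sub w g : reached w -> g \in G -> g w = w -> g \in H.
Proof.
case=> h Hh <- Gg fix_g; have Gh := subsetP sHG h Hh.
have -> : g = (g ^ h^-1) ^ h by rewrite conjgKV.
rewrite groupJ // (subsetP sCH) // inE groupJ ?groupV //=.
apply/astab1P; rewrite /= /aperm conjgE invgK !permM fix_g permK //.
Qed.

Lemma line_reachedJ w i x j : wr x j \in H -> line_reached w i ->
  line_reached (wr x j w) (i + j)%R.
Proof.
move=> Hs Lw u eq_uw; rewrite -[u](permKV (wr x j)).
apply: reachedJ => //; apply: Lw => k nik.
have /eq_uw : (k + j != i + j)%R by rewrite (inj_eq (GRing.addIr _)).
by rewrite -{1}[u](permKV (wr x j)) !wrE GRing.addrK => /perm_inj.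
Qed.

(** The shift by [j - i], corrected by elements of [N] so as to fix [w], lies in [H] and turns
    direction [i] into direction [j]. *)
Lemma line_reached_any w i j : reached w -> line_reached w i -> line_reached w j.
Proof.
move=> Rw Lw; have [x [Nx xw]] := wr_trans [ffun k => w (k - (j - i))%R] w.
have fix_w : wr x (j - i)%R w = w.
  apply/ffunP=> k; rewrite -{2}xw !wrE ffunE GRing.subr0 //.
have Hx : wr x (j - i)%R \in H.
  by rewrite (stab_sub Rw) //; apply/mem_twisted/congruent_in.
by have := line_reachedJ Hx Lw; rewrite fix_w GRing.addrC GRing.subrK.
Qed.

Lemma all_reached w i : reached w -> line_reached w i ->  forall u, reached u.
Proof.
move=> Rw Lw u.
(* An element of [H] taking [w] to [w'] carries the given line to a line through [w'] in some
   direction, hence all directions occur there. *)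
have Ls w' j : reached w' -> line_reached w' j.
  case: (Rw) => h Hh hv [g Hg gv].
  have Hs : h^-1 * g \in H by rewrite groupM ?groupV.
  have sw : (h^-1 * g) w = w' by rewrite permM -hv permK.
  have [x [k [_ def_s]]] := twistedP (subsetP sHG _ Hs).
  have Rw' : reached w' by exists g.
  apply: (line_reached_any (i := (i + k)%R)) => //.
  by rewrite -sw def_s; apply: line_reachedJ => //; rewrite -def_s.
(* Walk from [w] to [u] changing one coordinate at a time, each move staying on a line. *)
have main (e : seq 'F_p) : reached [ffun k => if k \in e then u k else w k].
  elim: e => [|i0 e IHe].
    by rewrite (_ : [ffun k => _] = w) //; apply/ffunP=> k; rewrite ffunE.
  apply: (Ls _ i0 IHe) => k nk; rewrite !ffunE inE (negPf nk) //.
rewrite (_ : u = [ffun k => if k \in enum 'F_p then u k else w k]) //.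
by apply/ffunP=> k; rewrite ffunE mem_enum inE.
Qed.

Lemma line_of_moved h : h \in H -> h v != v ->
  exists w i, reached w /\ line_reached w i.
Proof.
move=> Hh mv; pose w := h v; have Rw : reached w by exists h.
have /existsP[i nwi] : [exists i, w i != v i].
  apply: contraR mv => /existsPn eq_wv; apply/eqP/ffunP=> i.
  by apply/eqP; rewrite -[_ == _]negbK eq_wv.
exists w, i; split=> // u eq_uw.
(* Acting by [n] at coordinate [i] alone fixes [v], so it lies in [H]; it moves [w] to a second
   orbit point on the line in direction [i]. *)
have [n [Nn nv nw]] := N_stab nwi.
pose y k := if k == i then n else 1.
have Hy : wr y 0%R \in H.
  apply: (@stab_sub v); first by exists 1; rewrite ?group1 ?perm1.
    by apply/mem_twisted/congruent_in=> k; rewrite /y; case: ifP.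
  apply/ffunP=> k; rewrite wrE GRing.subr0 /y.
  by case: eqP => [->|_]; rewrite ?perm1.
have Ryw := reachedJ Hy Rw.
have [eq_uwi|nuwi] := eqVneq (u i) (w i).
  rewrite (_ : u = w) //; apply/ffunP=> k.
  by have [->|/eq_uw] := eqVneq k i.
have [g [Pg gw gnw]] := P_trans2 nw nuwi.
(* Now [g] takes the second point to [u] at coordinate [i]. The corrections [m k] in [N] extend [g]
   to a congruent tuple fixing [w], which therefore lies in [H]. *)
have /fin_all_exists[m mP] k : exists m, m \in N /\ m (g (w k)) = w k.
  by have [m] := N_trans (g (w k)) (w k); exists m.
pose x k := if k == i then g else g * m k.
have PN := subsetP (normal_sub nsNP).
have ex k : x k \in P /\ coset N (x k) = coset N g.
  have [Nm _] := mP k; rewrite /x; case: eqP => // _.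
  by have Pm := PN _ Nm; rewrite groupM // cosetM // (coset_id Nm) mulg1.
have Hx : wr x 0%R \in H.
  apply: (stab_sub Rw).
    apply/mem_twisted/congruentP=> k; have [-> ->] := ex k.
    by have [_ ->] := ex 0%R.
  apply/ffunP=> k; rewrite wrE GRing.subr0 /x.
  by case: eqP => [->|_] //; rewrite permM; case: (mP k).
rewrite (_ : u = wr x 0%R (wr y 0%R w)); first exact: reachedJ.
apply/ffunP=> k; rewrite !wrE !GRing.subr0 /x /y.
have [->|/eq_uw->] := eqVneq k i; first by rewrite gnw.
by rewrite perm1 permM; case: (mP k).
Qed.

Lemma stab_maximal : H = 'C_G[v | 'P] :> {set _} \/ H = G :> {set _}.
Proof.
have [[h /andP[Hh mv]]|fixH] :=
  altP (@existsP _ (fun h => (h \in H) && (h v != v))).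
  right; apply/eqP; rewrite eqEsubset sHG; apply/subsetP=> g Gg.
  have [w [i [Rw Lw]]] := line_of_moved Hh mv.
  have [k Hk kv] := all_reached Rw Lw (g v).
  (* Since [k] and [g] agree at [v], the product [g * k^-1] fixes [v]. *)
  rewrite -(mulgKV k g) groupM //; apply: (@stab_sub v).
  - by exists 1; rewrite ?group1 ?perm1.
  - by rewrite groupM ?groupV // (subsetP sHG).
  by rewrite permM -kv permK.
left; apply/eqP; rewrite eqEsubset sCH andbT; apply/subsetP=> h Hh.
rewrite inE (subsetP sHG) //; apply/astab1P; apply: contraNeq fixH => mv.
by apply/existsP; exists h; rewrite Hh.
Qed.

End Maximality.

Lemma wr_primitive (o : Omega) : [primitive G, on [set: vect] | 'P].
Proof.
rewrite (@trans_prim_astab _ _ _ _ _ [ffun=> o]) ?inE ?wr_transitive //.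
apply/maximal_eqP; split=> [|H sCH sHG]; first exact: subsetIl.
by have [eqH | eqH] := stab_maximal sCH sHG; [left | right];
  apply/eqP; rewrite -val_eqE /= eqH.
Qed.

End ProductAction.

(** * The Dickson nearfield of order q^2 *)

Section Nearfield.
Import GroupScope GRing.Theory.
Local Open Scope ring_scope.

Variables (F : finFieldType) (p f : nat).
Let q := (p ^ f)%N.
Hypothesis pcharF : p \in [pchar F].
Hypothesis cardF : #|F| = (q ^ 2)%N.
Hypothesis q_mod4 : (q = 3 %[mod 4])%N.
Implicit Types a b c x y w u : F.

Let h := (q.+1)./2.

Lemma q_split : exists k, q = (4 * k + 3)%N.
Proof. by exists (q %/ 4)%N; rewrite {1}(divn_eq q 4) q_mod4 mulnC. Qed.

Lemma h_double : (h * 2 = q.+1)%N.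
Proof.
have [k eq_q] := q_split; rewrite /h eq_q muln2 halfK.
by rewrite -addnS oddD oddM /= subn0.
Qed.

Lemma odd_q : odd q.
Proof. by have [k ->] := q_split; rewrite oddD oddM. Qed.

Lemma even_predq : exists k, q.-1 = (2 * k)%N.
Proof.
have [k ->] := q_split; exists (2 * k + 1)%N.
by rewrite mulnDr mulnA addnS.
Qed.

Lemma q_gt2 : (2 < q)%N.
Proof. by have [k ->] := q_split; rewrite addn3. Qed.

Lemma predq_gt0 : (0 < q.-1)%N.
Proof. by have [k ->] := q_split; rewrite addn3. Qed.

Let q_gt0 : (0 < q)%N := ltnW (ltnW q_gt2).
Let order_ge : (q ^ 2).-1 = (q.-1 * q.+1)%N.
Proof. by rewrite -subn1 -[1%N in LHS](exp1n 2) subn_sqr subn1 addn1. Qed.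

Lemma frobD x y : (x + y) ^+ q = x ^+ q + y ^+ q.
Proof.
apply: exprDn_pchar; rewrite pnatX /=; apply/orP; left.
by rewrite (eq_pnat _ (pcharf_eq pcharF)) pnat_id // (pcharf_prime pcharF).
Qed.

Lemma frobK x : (x ^+ q) ^+ q = x.
Proof. by rewrite -exprM mulnn -cardF expf_card. Qed.

Lemma expf_order x : x != 0 -> x ^+ (q.-1 * q.+1) = 1.
Proof.
move=> nz_x; apply: (mulfI nz_x); rewrite mulr1 -exprS -order_ge prednK.
  by rewrite -cardF expf_card.
by rewrite expn_gt0 q_gt0.
Qed.

(* The quadratic character of F, since (q - 1) h = (q^2 - 1) / 2. *)
Definition chi x := x ^+ (q.-1 * h).

Lemma chiM x y : chi (x * y) = chi x * chi y.
Proof. exact: exprMn. Qed.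

Lemma chi_sqr x : x != 0 -> chi x ^+ 2 = 1.
Proof. by move=> nz_x; rewrite -exprM -mulnA h_double expf_order. Qed.

Lemma chi_even x k : x != 0 -> chi (x ^+ (2 * k)) = 1.
Proof. by move=> nz_x; rewrite /chi exprAC exprM [_ ^+ 2]chi_sqr ?expr1n. Qed.

Lemma chi_frob x : x != 0 -> chi (x ^+ q) = chi x.
Proof.
move=> nz_x; have [k eq_q] := even_predq.
by rewrite -(prednK q_gt0) eq_q exprS chiM chi_even ?mulr1.
Qed.

Lemma chi_pm1 x : x != 0 -> chi x != 1 -> chi x = -1.
Proof.
move=> nz_x; have /eqP := chi_sqr nz_x; rewrite sqrf_eq1.
by case/predU1P=> [->|/eqP->]; rewrite ?eqxx.
Qed.

(** The hypothesis says that [a] is a nonzero element of the subfield of order [q]; such elements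
    are squares in [F]. *)
Lemma chi_fixed a : a ^+ q.-1 = 1 -> chi a = 1.
Proof. by move=> a1; rewrite /chi exprM a1 expr1n. Qed.

Lemma fixed_nz a : a ^+ q.-1 = 1 -> a != 0.
Proof.
apply: contra_eq_neq => ->; rewrite expr0n eq_sym.
by have [k ->] := q_split; rewrite addn3 oner_eq0.
Qed.

Definition nf_mul a x := if chi a == 1 then a * x else a * x ^+ q.

Lemma nf_mulr1 a : nf_mul a 1 = a.
Proof. by rewrite /nf_mul expr1n mulr1 if_same. Qed.

Lemma nf_mulr0 a : nf_mul a 0 = 0.
Proof. by rewrite /nf_mul expr0n eqn0Ngt q_gt0 mulr0 if_same. Qed.

Lemma nf_mulD a x y : nf_mul a (x + y) = nf_mul a x + nf_mul a y.
Proof. by rewrite /nf_mul frobD !mulrDr; case: ifP. Qed.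

Lemma nf_mulN a x : nf_mul a (- x) = - nf_mul a x.
Proof. by apply/eqP; rewrite -addr_eq0 -nf_mulD addNr nf_mulr0. Qed.

Lemma nf_mul_eq0 a x : a != 0 -> (nf_mul a x == 0) = (x == 0).
Proof.
move=> nz_a; rewrite /nf_mul; case: ifP => _; rewrite mulf_eq0 (negPf nz_a) //.
by rewrite expf_eq0 q_gt0.
Qed.

Lemma chi_nf_mul a b : a != 0 -> b != 0 -> chi (nf_mul b a) = chi b * chi a.
Proof. by move=> nz_a nz_b; rewrite /nf_mul; case: ifP; rewrite chiM ?chi_frob. Qed.

(** The Frobenius twists compose as the characters multiply: [chi] is multiplicative for [nf_mul],
    and two twists cancel by [frobK]. *)
Lemma nf_mulA a b x : a != 0 -> b != 0 ->
  nf_mul b (nf_mul a x) = nf_mul (nf_mul b a) x.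
Proof.
move=> nz_a nz_b; rewrite {3}/nf_mul chi_nf_mul // /nf_mul.
have [a1|na1] := eqVneq (chi a) 1; have [b1|nb1] := eqVneq (chi b) 1.
- by rewrite a1 b1 mulr1 eqxx mulrA.
- by rewrite a1 mulr1 (negPf nb1) exprMn mulrA.
- by rewrite b1 mul1r (negPf na1) mulrA.
by rewrite (chi_pm1 nz_a na1) (chi_pm1 nz_b nb1) mulrNN mulr1 eqxx exprMn frobK mulrA.
Qed.

Lemma nf_mul_trans y z : y != 0 -> z != 0 -> exists2 a, a != 0 & nf_mul a y = z.
Proof.
move=> nz_y nz_z.
(* The candidates [z / y] and [z / y ^+ q] have the same character, which decides which of them
   solves the equation. *)
have [yz1|nyz1] := eqVneq (chi (z / y)) 1.
  by exists (z / y); rewrite /nf_mul ?mulf_neq0 ?invr_eq0 // yz1 eqxx divfK.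
exists (z / y ^+ q); first by rewrite mulf_neq0 ?invr_eq0 ?expf_neq0.
have -> : nf_mul (z / y ^+ q) y = z / y ^+ q * y ^+ q.
  rewrite /nf_mul ifN //; apply: contra nyz1.
  by rewrite !chiM -!exprVn chi_frob ?invr_eq0.
by rewrite divfK ?expf_neq0.
Qed.

(** * The affine group of the nearfield and its normal subgroup of scalar type *)

Definition aff_fun a w x := if a == 0 then x else nf_mul a x + w.

Lemma aff_fun_inj a w : injective (aff_fun a w).
Proof.
rewrite /aff_fun => x y; case: eqVneq => // nz_a /addIr/eqP.
by rewrite -subr_eq0 -nf_mulN -nf_mulD nf_mul_eq0 // subr_eq0 => /eqP.
Qed.

(** The identity as default value at [a = 0] makes this a permutation for every pair. *)
Definition aff a w : {perm F} := perm (@aff_fun_inj a w).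

Lemma affE a w x : a != 0 -> aff a w x = nf_mul a x + w.
Proof. by move=> nz_a; rewrite permE /aff_fun (negPf nz_a). Qed.

Lemma aff_inj a w b u : a != 0 -> b != 0 -> aff a w = aff b u -> a = b /\ w = u.
Proof.
move=> nz_a nz_b /permP eq_ab.
have eq_wu : w = u by have := eq_ab 0; rewrite !affE // !nf_mulr0 !add0r.
by have := eq_ab 1; rewrite !affE // !nf_mulr1 eq_wu => /addIr.
Qed.

Lemma affM a w b u : a != 0 -> b != 0 ->
  (aff a w * aff b u)%g = aff (nf_mul b a) (nf_mul b w + u).
Proof.
move=> nz_a nz_b; apply/permP=> x; rewrite permM !affE ?nf_mul_eq0 //.
by rewrite nf_mulD nf_mulA // addrA.
Qed.

Lemma aff1 : aff 1 0 = 1%g.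
Proof.
apply/permP=> x; rewrite affE ?oner_eq0 // perm1 addr0.
by rewrite /nf_mul chi_fixed ?expr1n // eqxx mul1r.
Qed.

Definition aff_set : {set {perm F}} :=
  [set aff u.1 u.2 | u : F * F & u.1 != 0].

Definition scalar_set : {set {perm F}} :=
  [set aff u.1 u.2 | u : F * F & u.1 ^+ q.-1 == 1].

Lemma aff_setP s :
  reflect (exists a w, a != 0 /\ s = aff a w) (s \in aff_set).
Proof.
apply: (iffP imsetP) => [[[a w]]|[a [w [nz_a ->]]]].
  by rewrite inE /= => nz_a ->; exists a, w.
by exists (a, w); rewrite ?inE.
Qed.

Lemma scalar_setP s :
  reflect (exists a w, a ^+ q.-1 = 1 /\ s = aff a w) (s \in scalar_set).
Proof.
apply: (iffP imsetP) => [[[a w]]|[a [w [a1 ->]]]].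
  by rewrite inE /= => /eqP a1 ->; exists a, w.
by exists (a, w); rewrite ?inE //= a1.
Qed.

Lemma mem_aff a w : a != 0 -> aff a w \in aff_set.
Proof. by move=> nz_a; apply/aff_setP; exists a, w. Qed.

Lemma mem_scalar a w : a != 0 -> (aff a w \in scalar_set) = (a ^+ q.-1 == 1).
Proof.
move=> nz_a; apply/scalar_setP/eqP => [[b [u [b1]]]|a1]; last by exists a, w.
by case/aff_inj=> //; [apply: fixed_nz | move=> ->].
Qed.

Lemma nf_mul_scalar a x : a ^+ q.-1 = 1 -> nf_mul a x = a * x.
Proof. by move=> a1; rewrite /nf_mul chi_fixed ?eqxx. Qed.

Lemma nf_scalarC a b : a ^+ q.-1 = 1 -> nf_mul b a = b * a.
Proof.
by move=> a1; rewrite /nf_mul -(prednK q_gt0) exprS a1 mulr1 if_same.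
Qed.

Lemma aff_group_set : group_set aff_set.
Proof.
apply/group_setP; split; first by rewrite -aff1 mem_aff ?oner_eq0.
move=> _ _ /aff_setP[a [w [nz_a ->]]] /aff_setP[b [u [nz_b ->]]].
by rewrite affM // mem_aff ?nf_mul_eq0.
Qed.
Canonical aff_group := Group aff_group_set.

Lemma scalar_group_set : group_set scalar_set.
Proof.
apply/group_setP; split; first by rewrite -aff1 mem_scalar ?oner_eq0 ?expr1n.
move=> _ _ /scalar_setP[a [w [a1 ->]]] /scalar_setP[b [u [b1 ->]]].
have [nz_a nz_b] := (fixed_nz a1, fixed_nz b1).
by rewrite affM // mem_scalar ?nf_mul_eq0 // nf_scalarC // exprMn a1 b1 mulr1.
Qed.
Canonical scalar_group := Group scalar_group_set.

Local Notation P := aff_group.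
Local Notation N := scalar_group.

Lemma scalar_normal : N <| P.
Proof.
apply/andP; split.
  by apply/subsetP=> _ /scalar_setP[a [w [/fixed_nz nz_a ->]]]; apply: mem_aff.
apply/subsetP=> _ /aff_setP[b [u [nz_b ->]]]; rewrite inE.
apply/subsetP=> _ /imsetP[_ /scalar_setP[a [w [a1 ->]]] ->].
have nz_a := fixed_nz a1.
(* As [a] lies in the subfield of order [q], it commutes with [b] for [nf_mul], so conjugation
   changes only the translation part. *)
suffices -> : (aff a w ^ aff b u)%g = aff a (nf_mul b w + u - a * u).
  by rewrite mem_scalar ?a1.
rewrite conjgE; apply: (mulgI (aff b u)); rewrite mulKVg !affM //.
rewrite (nf_scalarC b a1) !(nf_mul_scalar _ a1) [a * b]mulrC; congr (aff _ _).
by rewrite [RHS]addrC subrK.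
Qed.

(** Fixed points solve [x - nf_mul a x = w], so it suffices that this additive map of [x] is
    injective. If [nf_mul a z = z] with [z] nonzero, then either [a = 1], or [a] is a nonsquare with
    [a * z ^+ q.-1 = 1], impossible since [q - 1] is even. *)
Lemma aff_fix1 s : s \in P :\: N -> exists x, forall y, (s y == y) = (y == x).
Proof.
case/setDP=> /aff_setP[a [w [nz_a ->]]]; rewrite mem_scalar // => na1.
have dif_inj : injective (fun x => x - nf_mul a x).
  move=> x y /= eq_xy; apply/eqP; rewrite -subr_eq0; set z := x - y.
  have fix_z : nf_mul a z = z.
    apply/eqP; rewrite eq_sym -subr_eq0 /z nf_mulD nf_mulN opprD addrACA eq_xy.
    by rewrite opprK addrACA subrr addNr addr0.
  apply: contraR na1 => nz_z; move: fix_z; rewrite /nf_mul.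
  have [_ az|nchi az] := eqVneq (chi a) 1.
    by rewrite (mulIf nz_z (etrans az (esym (mul1r z)))) expr1n.
  have azq : a * z ^+ q.-1 = 1.
    by apply: (mulIf nz_z); rewrite mul1r -mulrA -exprSr prednK.
  case/eqP: nchi; have [k eq_q] := even_predq.
  have := congr1 chi azq; rewrite chiM eq_q chi_even // mulr1 => ->.
  exact: expr1n.
have [g gK Kg] := injF_bij dif_inj; exists (g w) => y.
by rewrite affE // eq_sym addrC -subr_eq (can2_eq gK Kg).
Qed.

Lemma scalar_trans x y : exists2 s, s \in N & s x = y.
Proof.
exists (aff 1 (y - x)); first by rewrite mem_scalar ?oner_eq0 ?expr1n.
by rewrite affE ?oner_eq0 // nf_mul_scalar ?expr1n // mul1r addrC subrK.
Qed.

Lemma scalar_der : exists2 s, s \in N & forall x, s x != x.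
Proof.
exists (aff 1 1); first by rewrite mem_scalar ?oner_eq0 ?expr1n.
move=> x; rewrite affE ?oner_eq0 // nf_mul_scalar ?expr1n // mul1r.
by rewrite -subr_eq0 addrC addKr oner_eq0.
Qed.

Lemma two_neq0 : 2%:R != 0 :> F.
Proof.
rewrite -(GRing.dvdn_pcharf pcharF); apply/negP=> p2.
move: p2 odd_q q_gt2; rewrite dvdn_prime2 ?(pcharf_prime pcharF) // /q => /eqP->.
by rewrite oddX orbF => /eqP->.
Qed.

Lemma scalar_stab x y : y != x -> exists s, [/\ s \in N, s x = x & s y != y].
Proof.
move=> nyx; have N1 : (- 1 : F) ^+ q.-1 = 1.
  by have [k ->] := even_predq; rewrite exprM sqrrN !expr1n.
have nzN1 := fixed_nz N1.
(* The point reflection in [x], which fixes only [x] because the characteristic is odd. *)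
exists (aff (- 1) (x + x)); split; first by rewrite mem_scalar ?N1.
  by rewrite affE // nf_mul_scalar // mulN1r addKr.
rewrite affE // nf_mul_scalar // mulN1r addrC subr_eq.
rewrite -!mulr2n -[x *+ 2]mulr_natl -[y *+ 2]mulr_natl.
by rewrite (inj_eq (mulfI two_neq0)) eq_sym.
Qed.

Lemma aff_trans2 x y z : y != x -> z != x ->
  exists s, [/\ s \in P, s x = x & s y = z].
Proof.
move=> nyx nzx.
have [a nz_a aP] : exists2 a, a != 0 & nf_mul a (y - x) = z - x.
  by apply: nf_mul_trans; rewrite subr_eq0.
exists (aff a (x - nf_mul a x)); rewrite mem_aff // !affE //; split=> //.
  by rewrite addrC subrK.
by rewrite addrCA -nf_mulN -nf_mulD aP addrC subrK.
Qed.

Lemma prim_root_ex : {g : F | (q.-1 * q.+1).-primitive_root g}.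
Proof.
have nz_enum x : (x \in enum (predC1 (0 : F))) = (x != 0) by rewrite mem_enum inE.
have M_gt0 : (0 < q.-1 * q.+1)%N by rewrite muln_gt0 -ltnS prednK ?(ltnW q_gt2).
have /hasP/sig2W[g _ gP] : has (q.-1 * q.+1).-primitive_root (enum (predC1 (0 : F))).
  apply: has_prim_root => //; last by rewrite -cardE cardC1 cardF order_ge.
    by apply/allP=> x; rewrite nz_enum => /expf_order/eqP; rewrite unity_rootE.
  exact: enum_uniq.
by exists g.
Qed.

(** * The order and the dihedral structure of [P / N] *)

Section Generator.

Variable g : F.
Hypothesis gP : (q.-1 * q.+1).-primitive_root g.

Let nz_g : g != 0.
Proof.
apply: contra_eq_neq (prim_expr_order gP) => ->.
by rewrite expr0n gtn_eqF ?(prim_order_gt0 gP) // eq_sym oner_eq0.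
Qed.

Lemma expg_neq1 n : (0 < n < q.-1 * q.+1)%N -> g ^+ n != 1.
Proof. by case/andP=> n_gt0 ltn; rewrite -(prim_order_dvd gP) gtnNdvd. Qed.

Lemma chi_gen : chi g = -1.
Proof.
apply: chi_pm1 => //; apply: expg_neq1.
have h_gt0 : (0 < h)%N by rewrite -(ltn_pmul2r (m := 2)) // h_double.
rewrite muln_gt0 h_gt0 predq_gt0 ltn_pmul2l ?predq_gt0 //.
by rewrite -h_double ltn_Pmulr.
Qed.

Lemma card_fixed : #|[set a : F | a ^+ q.-1 == 1]| = q.-1.
Proof.
have g'P := dvdn_prim_root gP (dvdn_mulr _ (dvdnn q.-1)).
set g' := g ^+ _ in g'P.
have inj_g' : injective (fun i : 'I_q.-1 => g' ^+ i).
  move=> i j /eqP; rewrite (eq_prim_root_expr g'P) !modn_small ?ltn_ord //.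
  by move/eqP/val_inj.
rewrite -[RHS]card_ord -(card_imset _ inj_g').
apply: eq_card => a; rewrite inE; apply/eqP/imsetP=> [a1|[i _ ->]].
  by have [i ->] := prim_rootP g'P a1; exists i.
by rewrite exprAC (prim_expr_order g'P) expr1n.
Qed.

Lemma card_aff_family (A : pred F) : (forall a, A a -> a != 0) ->
  #|[set aff u.1 u.2 | u : F * F & A u.1]| = (#|A| * q ^ 2)%N.
Proof.
move=> nzA; rewrite card_in_imset => [|[a w] [b u]]; last first.
  by rewrite !inE /= => /nzA nz_a /nzA nz_b /aff_inj[] // -> ->.
rewrite -cardF -cardX; apply: eq_card => u.
by rewrite !inE andbT.
Qed.

Lemma card_quotient_aff : #|(P / N)%g| = q.+1.
Proof.
have nsNP := scalar_normal.
rewrite card_quotient ?normal_norm // -divgS ?normal_sub //=.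
rewrite (@card_aff_family (fun a : F => a != 0)) //.
rewrite (@card_aff_family (fun a : F => a ^+ q.-1 == 1)); last first.
  by move=> a /eqP; apply: fixed_nz.
rewrite cardC1 cardF order_ge -cardsE card_fixed mulnAC mulKn //.
by rewrite muln_gt0 predq_gt0 expn_gt0 q_gt0.
Qed.

Lemma aff_even i : (aff (g ^+ 2)%R 0%R ^+ i)%g = aff (g ^+ (2 * i)) 0.
Proof.
elim: i => [|i IHi]; first by rewrite muln0 expr0 aff1.
rewrite expgS IHi affM ?expf_neq0 // nf_mulr0 addr0; congr (aff _ _).
by rewrite /nf_mul chi_even // eqxx -exprD mulnS addnC.
Qed.

Lemma gen_mul x : nf_mul g x = g * x ^+ q.
Proof.
by rewrite /nf_mul chi_gen ifN // eq_sym -subr_eq0 opprK two_neq0.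
Qed.

Lemma aff_quotient_dihedral : (P / N)%g \isog [set: 'D_q.+1].
Proof.
(* Both multipliers are nonsquares, and both squares are multiplication by the norm [g ^+ q.+1],
   which lies in [N]. The exponent [q] is chosen so that [y * x] is multiplication by [g ^+ 2]. *)
pose x := aff g 0; pose y := aff (g ^+ q) 0.
have nzq : g ^+ q != 0 by rewrite expf_neq0.
have nNP := subsetP (normal_norm scalar_normal).
have [Px Py] : x \in P /\ y \in P by rewrite !mem_aff.
have cosetM : {in P &, {morph coset N : s t / (s * t)%g}}.
  by move=> s t Ps Pt; rewrite /= morphM ?nNP.
have yx : (y * x)%g = aff (g ^+ 2) 0.
  by rewrite affM // gen_mul nf_mulr0 addr0 frobK.
have chi_gq : chi (g ^+ q) = -1 by rewrite chi_frob // chi_gen.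
have nf_gq z : nf_mul (g ^+ q) z = g ^+ q * z ^+ q.
  by rewrite /nf_mul chi_gq ifN // eq_sym -subr_eq0 opprK two_neq0.
have nN1 a : a ^+ q.-1 != 1 -> a != 0 -> coset N (aff a 0) != 1%g.
  move=> na1 nz_a; apply: contra na1 => /eqP/coset_idr.
  by rewrite nNP ?mem_aff // mem_scalar // => /(_ isT).
have sqr1 z : z \in P -> (z * z)%g = aff (g ^+ q.+1) 0 ->
    (coset N z ^+ 2)%g = 1%g.
  move=> Pz zz; rewrite expgS expg1 -cosetM // zz; apply: coset_id.
  by rewrite mem_scalar ?expf_neq0 // -exprM mulnC (prim_expr_order gP).
have X2 : (coset N x ^+ 2)%g = 1%g.
  by apply: sqr1; rewrite ?affM // gen_mul nf_mulr0 addr0 exprS.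
have Y2 : (coset N y ^+ 2)%g = 1%g.
  by apply: sqr1; rewrite ?affM // nf_gq nf_mulr0 addr0 frobK -exprSr.
have gq1 : g ^+ q.-1 != 1.
  by rewrite expg_neq1 // predq_gt0 ltn_Pmulr // predq_gt0.
have oX : #[coset N x]%g = 2 by rewrite (nt_prime_order _ X2) ?nN1.
have oY : #[coset N y]%g = 2.
  rewrite (nt_prime_order _ Y2) ?nN1 //; apply: contra gq1 => /eqP gqq.
  by rewrite -[g ^+ q.-1]frobK [(g ^+ q.-1) ^+ q]exprAC gqq expr1n.
(* If the two involutions agreed, their product would be trivial, whereas [g ^+ 2] has order greater
   than [q - 1]. *)
have neqXY : coset N x != coset N y.
  apply: contraTneq isT => eqXY.
  have : coset N (aff (g ^+ 2) 0) != 1%g.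
    rewrite nN1 ?expf_neq0 // -exprM expg_neq1 // muln_gt0 predq_gt0 /=.
    by rewrite mulnC ltn_pmul2l ?predq_gt0 // (ltn_trans q_gt2).
  by rewrite -yx cosetM // -eqXY -X2 expgS expg1 eqxx.
have genXY : (P / N)%g = <<[set coset N x; coset N y]>>%g.
  apply/eqP; rewrite eqEsubset gen_subG andbC; apply/andP; split.
    by apply/subsetP=> z /set2P[]->; apply: mem_quotient.
  apply/subsetP=> _ /morphimP[_ _ /aff_setP[a [w [nz_a ->]]] ->].
  (* Translations lie in [N], so only the multiplier, a power of [g], matters: even powers come from
     [y * x], odd ones need one more factor [x]. *)
  have -> : aff a w = (aff a 0%R * aff 1%R w)%g.
    rewrite affM ?oner_eq0 // !nf_mul_scalar ?expr1n //.
    by rewrite !mul1r add0r.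
  rewrite /= coset_kerr ?mem_scalar ?oner_eq0 ?expr1n //.
  have [i ->] := prim_rootP gP (expf_order nz_a).
  have genX : coset N x \in <<[set coset N x; coset N y]>>%g.
    by rewrite mem_gen ?set21.
  have genY : coset N y \in <<[set coset N x; coset N y]>>%g.
    by rewrite mem_gen ?set22.
  have gen_even k : coset N (aff (g ^+ (2 * k)) 0) \in
      <<[set coset N x; coset N y]>>%g.
    by rewrite -aff_even -yx morphX ?nNP ?groupM //= cosetM // groupX ?groupM.
  rewrite -(odd_double_half i) -mul2n; case: (odd i); last by rewrite add0n.
  have -> : aff (g ^+ (1 + 2 * i./2)) 0 = (x * aff (g ^+ (2 * i./2))%R 0%R)%g.
    rewrite affM ?expf_neq0 // nf_mulr0 addr0 /nf_mul chi_even // eqxx.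
    by rewrite -exprSr.
  by rewrite cosetM ?mem_aff ?expf_neq0 // groupM.
by have := involutions_gen_dihedral oX oY neqXY; rewrite -genXY card_quotient_aff.
Qed.

End Generator.

End Nearfield.

(** * The primitive group with dihedral quotient *)

Theorem lemma7p1 (p f : nat) (p_prime : prime p) (f_ge1 : (1 <= f)%N)
    (q_mod4 : (p ^ f = 3 %[mod 4])%N) :
  exists (T : finType) (G : {group {perm T}}),
    [primitive G, on [set: T] | 'P] /\
    (G / derangement_subgroup G)%g \isog [set: 'D_((p ^ f).+1)].
Proof.
have f2_gt0 : (0 < f * 2)%N by rewrite muln_gt0 f_ge1.
have [F pcharF cardF] := pPrimePowerField p_prime f2_gt0.
rewrite expnM in cardF.
have [g gP] := prim_root_ex cardF q_mod4.
have isoPN := aff_quotient_dihedral pcharF cardF q_mod4 gP.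
have nsNP := scalar_normal pcharF cardF q_mod4.
(* The quotient has order [q + 1], and [p] divides [q]. *)
have coNP : coprime p #|(aff_group pcharF cardF q_mod4
    / scalar_group pcharF cardF q_mod4)%g|.
  rewrite (card_quotient_aff pcharF cardF q_mod4 gP) prime_coprime //.
  apply/negP=> p_q1; have : (p %| 1)%N.
    by rewrite -(dvdn_addr 1 (dvdn_exp f_ge1 (dvdnn p))) addn1.
  by rewrite dvdn1; case: eqP p_prime => // ->.
(* The number of coordinates is the characteristic [p], a convenient prime not dividing [q + 1]. *)
exists {ffun 'F_p -> F}, (twisted_group p nsNP).
split.
  apply: wr_primitive; last exact: GRing.zero.
  - exact: scalar_trans.
  - exact: aff_trans2.
  exact: scalar_stab.
apply: isog_trans isoPN; apply: wr_quotient => //; first exact: aff_fix1.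
exact: scalar_der.
Qed.
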